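(* There exists a class $\mathcal{F}$ of boolean functions of unbounded arity such that every function $f \in \mathcal{F}$ of arity $n$ has $\mathcal{SDD}_c$ size in $O(n^3)$ and $\mathcal{OBDD}$ size in $2^{\Omega(n)}$.
   Context: Circuits are NNFs: boolean circuits (DAGs with a single output gate) whose input gates are labelled by constants $\bot,\top$ or by literals $x,\neg x$ on variables, and whose internal gates are unbounded-fanin $\vee$- and $\wedge$-gates. The size of a circuit is the number of arcs of its DAG. For a gate $g$, $C_g$ denotes the subcircuit with output $g$ (all gates with a directed path to $g$). For a class $\mathcal{L}$ of circuits and a boolean function $f$, the $\mathcal{L}$ size of $f$ is $\mathcal{L}(f)=\min\{\mathrm{size}(C): C\in\mathcal{L}, C \text{ computes } f\}$. A vtree for a finite nonempty variable set $Y$ is a rooted, full, ordered binary tree whose leaves are identified bijectively with $Y$; for an internal node $v$, $v_l,v_r$ are its left and right children, $T_v$ the subtree rooted at $v$, and $Y_v$ the set of leaves of $T_v$. An SDD respecting a vtree $T$ is defined inductively: (i) a single gate labelled by a literal on a variable $x$ that is a leaf of $T$; (ii) a single gate labelled by a constant (any $T$); (iii) a circuit $C=\bigvee_{i=1}^m (C_{p_i}\wedge C_{s_i})$ with $m\ge 2$ (an output $\vee$-gate with wires from $m$ $\wedge$-gates, the $i$-th having wires from gates $p_i,s_i$) such that for some internal node $v$ of $T$ and all $i$: $C_{p_i}$ is an SDD respecting a subtree of $T_{v_l}$; $C_{s_i}$ is an SDD respecting a subtree of $T_{v_r}$; and, viewed as functions on $Y_{v_l}$, $C_{p_i}\not\equiv\bot$,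 $C_{p_i}\wedge C_{p_j}\equiv\bot$ for $i<j$, and $\bigvee_i C_{p_i}\equiv\top$. An SDD is an SDD respecting some vtree. It is compressed if at every $\vee$-gate of the form in (iii) (relative to node $v$), the subs are pairwise nonequivalent as functions on $Y_{v_r}$: $C_{s_i}\not\equiv C_{s_j}$ for $i<j$. $\mathcal{SDD}_c$ is the class of compressed SDDs. A vtree is right-linear if every left child is a leaf. $\mathcal{OBDD}$ is the class of compressed SDDs respecting some right-linear vtree (these are exactly reduced ordered binary decision diagrams). *)

(* Defs.v *)
From mathcomp Require Import all_boot.

Set Implicit Arguments.
Unset Strict Implicit.
Unset Printing Implicit Defensive.

(* A circuit is over a fixed finite set [V] of variables; all functions of
   gates are functions of total assignments of [V].  Viewing the function of a
   gate whose literals are on variables of [Y] as a function on [Y] changes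
   neither (in)equivalence nor (un)satisfiability, since every assignment of
   [Y] extends to [V]. *)

Definition assignment (V : finType) := {ffun V -> bool}.

Definition boolfun (n : nat) := {ffun assignment 'I_n -> bool}.

(* [Lit x true] is the literal x, [Lit x false] is its negation. *)
Inductive label (V : Type) :=
  Const of bool | Lit of V & bool | Or | And.

Arguments Const {V} b.
Arguments Or {V}.
Arguments And {V}.

Definition input_label (V : Type) (l : label V) : bool :=
  match l with Const _ | Lit _ _ => true | Or | And => false end.

(* [arc h g] is a wire from [h] to [g], i.e. [h] is an input of [g]. *)
Record circuit (V : finType) := Circuit {
  gate : finType;
  arc : rel gate;
  lab : gate -> label V;
  out : gate;
  arc_acyclic : forall h g, arc h g -> ~~ connect arc g h;
  lab_input : forall g, input_label (lab g) = [forall h, ~~ arc h g];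
  out_unique : forall g, (g == out) = [forall h, ~~ arc g h]
}.

Arguments arc {V c} _ _.
Arguments lab {V c} _.
Arguments out {V} c.

Definition size_circuit (V : finType) (C : circuit V) : nat :=
  #|[set e : gate C * gate C | arc e.1 e.2]|.

(* Evaluation by recursion on a bound [k] on the number of gates of a path to
   [g]; [#|gate C|] is such a bound by acyclicity, see [evalE]. *)
Fixpoint eval_rec (V : finType) (C : circuit V) (a : assignment V) (k : nat)
    (g : gate C) : bool :=
  if k is k'.+1 then
    match lab g with
    | Const b => b
    | Lit x b => a x == b
    | Or => [exists h, arc h g && eval_rec a k' h]
    | And => [forall h, arc h g ==> eval_rec a k' h]
    end
  else false.

(* The function computed by the subcircuit of [C] with output [g]. *)
Definition eval (V : finType) (C : circuit V) (a : assignment V) (g : gate C) :=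
  eval_rec a #|gate C| g.

Lemma eval_rec_stable (V : finType) (C : circuit V) (a : assignment V) k k'
    (g : gate C) :
  #|[pred h | connect arc h g]| <= k -> #|[pred h | connect arc h g]| <= k' ->
  eval_rec a k g = eval_rec a k' g.
Proof.
have pos (u : gate C) : 0 < #|[pred h | connect arc h u]|.
  by apply/card_gt0P; exists u; rewrite inE connect0.
elim: k k' g => [|k IHk] [|k'] g; try by rewrite leqNgt pos.
  by move=> _; rewrite leqNgt pos.
move=> le_k le_k' /=.
have lt_m (h : gate C) : arc h g ->
    #|[pred u | connect arc u h]| < #|[pred u | connect arc u g]|.
  move=> hg; apply/proper_card/properP; split.
    apply/subsetP=> u; rewrite !inE => uh.
    exact: connect_trans uh (connect1 hg).
  by exists g; rewrite !inE ?connect0 //; apply: arc_acyclic.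
have eqh (h : gate C) : arc h g -> eval_rec a k h = eval_rec a k' h.
  by move=> /lt_m lt; apply: IHk; rewrite -ltnS; apply: leq_trans lt _.
case: (lab g) => //.
  apply: eq_existsb => h; case hg: (arc h g) => //=; exact: eqh.
apply: eq_forallb => h; case hg: (arc h g) => //=; exact: eqh.
Qed.

Lemma evalE (V : finType) (C : circuit V) (a : assignment V) (g : gate C) :
  eval a g = match lab g with
             | Const b => b
             | Lit x b => a x == b
             | Or => [exists h, arc h g && eval a h]
             | And => [forall h, arc h g ==> eval a h]
             end.
Proof.
rewrite /eval (@eval_rec_stable _ _ a #|gate C| #|gate C|.+1 g) //.
  exact: max_card.
exact: leq_trans (max_card _) (leqnSn _).
Qed.

Definition computes (n : nat) (C : circuit 'I_n) (f : boolfun n) : Prop :=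
  forall a, eval a (out C) = f a.

Inductive vtree (V : Type) := VLeaf of V | VNode of vtree V & vtree V.

Fixpoint leaves (V : Type) (T : vtree V) : seq V :=
  match T with
  | VLeaf x => [:: x]
  | VNode l r => leaves l ++ leaves r
  end.

Definition vtree_for (V : finType) (Y : {set V}) (T : vtree V) : bool :=
  uniq (leaves T) && ([set x in leaves T] == Y).

Fixpoint subtree (V : Type) (S T : vtree V) : Prop :=
  S = T \/
  match T with
  | VLeaf _ => False
  | VNode l r => subtree S l \/ subtree S r
  end.

Fixpoint right_linear (V : Type) (T : vtree V) : bool :=
  match T with
  | VLeaf _ => true
  | VNode (VLeaf _) r => right_linear r
  | VNode (VNode _ _) _ => false
  end.

(* In a decision gate, the children [h] of the or-gate play the role of the
   indices i; [p h] and [s h] are the corresponding prime and sub. *)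
Record decision (V : finType) (C : circuit V) (g : gate C)
    (p s : gate C -> gate C) : Prop := Decision {
  dec_or : lab g = Or;
  dec_fanin : 2 <= #|[set h | arc h g]|;
  dec_and : forall h, arc h g -> lab h = And;
  dec_wires : forall h, arc h g -> forall k, arc k h = (k \in [set p h; s h]);
  dec_sat : forall h, arc h g -> exists a, eval a (p h);
  dec_disjoint : forall h1 h2, arc h1 g -> arc h2 g -> h1 != h2 ->
    forall a, ~~ (eval a (p h1) && eval a (p h2));
  dec_cover : forall a, exists2 h, arc h g & eval a (p h)
}.

Definition subs_distinct (V : finType) (C : circuit V) (g : gate C)
    (s : gate C -> gate C) : Prop :=
  forall h1 h2, arc h1 g -> arc h2 g -> h1 != h2 ->
    exists a, eval a (s h1) != eval a (s h2).

(* [sdd_at false T g] (resp. [sdd_at true T g]): the subcircuit with output [g]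
   is an SDD (resp. a compressed SDD) respecting [T].  [tl h] and [tr h] are
   the subtrees of the two children of the node [VNode l r] that are respected
   by the prime and the sub of [h]. *)
Inductive sdd_at (V : finType) (C : circuit V) (compressed : bool) :
    vtree V -> gate C -> Prop :=
| SddLit T g x b :
    lab g = Lit x b -> x \in leaves T -> sdd_at compressed T g
| SddConst T g b :
    lab g = Const b -> sdd_at compressed T g
| SddDec T g l r p s (tl tr : gate C -> vtree V) :
    subtree (VNode l r) T ->
    decision g p s ->
    (forall h, arc h g -> subtree (tl h) l) ->
    (forall h, arc h g -> subtree (tr h) r) ->
    (forall h, arc h g -> sdd_at compressed (tl h) (p h)) ->
    (forall h, arc h g -> sdd_at compressed (tr h) (s h)) ->
    (compressed -> subs_distinct g s) ->
    sdd_at compressed T g.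

Definition SDDc (V : finType) (C : circuit V) : Prop :=
  exists (Y : {set V}) (T : vtree V), vtree_for Y T /\ sdd_at true T (out C).

Definition OBDD (V : finType) (C : circuit V) : Prop :=
  exists (Y : {set V}) (T : vtree V),
    [/\ vtree_for Y T, right_linear T & sdd_at true T (out C)].

Definition class_size (n : nat) (L : circuit 'I_n -> Prop) (f : boolfun n)
    (s : nat) : Prop :=
  (exists C, [/\ L C, computes C f & size_circuit C = s]) /\
  (forall C, L C -> computes C f -> s <= size_circuit C).

(* Main.v *)
From Pilot Require Import Defs.
From HB Require Import structures.
From mathcomp Require Import all_boot all_order all_algebra.
From mathcomp Require Import zify boolp reals exp.
Import Order.TTheory GRing.Theory Num.Theory.
(* MathComp's [path] also defines an [arc]. *)
Import Pilot.Defs.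

Set Implicit Arguments.
Unset Strict Implicit.
Unset Printing Implicit Defensive.

(* The witness is a disguised hidden weighted bit function: on variables
   x_0, ..., x_(n-1) and z_0, ..., z_n it tests whether z_c = x_c, where
   c = |x| is the number of ones of x and x_n stands for false.

   Compressed SDDs.  The satisfiable events [|x| = c and x_c = b] partition
   the assignments of x, and on such an event the function is the literal
   [z_c = b]; these literals are pairwise distinct.  Each event has O(n^2)
   subfunctions for the natural variable order, hence a reduced OBDD of that
   size, and these OBDDs are the primes of a single decision.

   OBDDs.  Set all z to true and let n = 6w.  Cut any variable order after
   4w variables A of x, so that 2w variables of x remain unread.  The windows
   [w, 3w) and [3w, 5w) miss 2w indices only, so that one of them, starting
   at s, contains w indices W of A.  Every subset of W extends within A to an
   assignment of weight exactly s.  Two distinct subsets of W differ at some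
   index v of W, and v - s <= 2w further ones among the unread variables make
   the function read x_v; hence the 2^w extensions lead to distinct gates. *)

(** * Acyclicity from a rank function *)

Section Rank.
Variables (T : finType) (e : rel T) (rk : T -> nat).
Hypothesis rk_lt : forall h g, e h g -> rk h < rk g.

Lemma connect_rank h g : connect e h g -> rk h <= rk g.
Proof.
case/connectP=> p; elim: p h => [|k p IHp] h /=; first by move=> _ ->.
by case/andP=> /rk_lt hk kp def_g; apply: leq_trans (ltnW hk) (IHp _ kp def_g).
Qed.

Lemma rank_acyclic h g : e h g -> ~~ connect e g h.
Proof.
by move=> /rk_lt hg; apply/negP=> /connect_rank; rewrite leqNgt hg.
Qed.

End Rank.

(** * Circuits cut out of a ranked labelled graph *)

Section Prune.
Variables (V G : finType) (r : rel G) (rank : G -> nat) (lb : G -> label V).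
Variable root : G.
Hypothesis rank_lt : forall h g, r h g -> rank h < rank g.
Hypothesis lb_input : forall g, input_label (lb g) = [forall h, ~~ r h g].

(** A [circuit] has its output as only sink. Keeping just the gates with a path to [root] enforces
    this, and loses no input of a gate that is kept. *)
Definition reach_gate : finType := {h : G | connect r h root}.
Definition reach_arc : rel reach_gate := fun h g => r (val h) (val g).

Lemma reach_pred h (g : reach_gate) : r h (val g) -> connect r h root.
Proof. by move=> hg; apply: connect_trans (connect1 hg) (valP g). Qed.

Lemma reach_acyclic h g : reach_arc h g -> ~~ connect reach_arc g h.
Proof.
by apply: (@rank_acyclic _ reach_arc (rank \o val)) => u v; apply: rank_lt.
Qed.

Lemma reach_input g :
  input_label (lb (val g)) = [forall h, ~~ reach_arc h g].
Proof.
rewrite lb_input; apply/forallP/forallP => [Hg h | Hg h]; first exact: Hg.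
by apply/negP=> hg; have := Hg (exist _ h (reach_pred hg));
  rewrite /reach_arc /= hg.
Qed.

Definition reach_out : reach_gate := exist _ root (connect0 r root).

Lemma reach_out_unique g : (g == reach_out) = [forall h, ~~ reach_arc g h].
Proof.
apply/eqP/forallP => [-> h | Hg].
  apply: contraL (valP h) => /(rank_acyclic rank_lt); exact: contra.
apply/val_inj => /=; case/connectP: (valP g) => [[|k p]] /=;
  first by move=> _ /esym.
case/andP=> gk kp def_r; have kr: connect r k root by apply/connectP; exists p.
by have := Hg (exist _ k kr); rewrite /reach_arc /= gk.
Qed.

Definition prune : circuit V :=
  Circuit reach_acyclic reach_input reach_out_unique.

Definition origin (g : gate prune) : G := val (g : reach_gate).

Lemma origin_inj : injective origin.
Proof. exact: val_inj. Qed.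

Lemma arc_prune (h g : gate prune) : arc h g = r (origin h) (origin g).
Proof. by []. Qed.

Lemma lab_prune (g : gate prune) : lab g = lb (origin g).
Proof. by []. Qed.

Lemma origin_pred h (g : gate prune) :
  r h (origin g) -> {h' : gate prune | origin h' = h}.
Proof. by move=> hg; exists (exist _ h (reach_pred hg)). Qed.

(** The default [h] is not reached when [f (origin h)] is an input of [origin h], since inputs of
    kept gates are kept. *)
Definition lift_pred (f : G -> G) (h : gate prune) : gate prune :=
  odflt h [pick k | origin k == f (origin h)].

Lemma origin_lift f h :
  r (f (origin h)) (origin h) -> origin (lift_pred f h) = f (origin h).
Proof.
move=> /origin_pred[k def_k]; rewrite /lift_pred.
by case: pickP => [k' /eqP//|/(_ k)/eqP[]].
Qed.

(** By induction on the rank, the gate equations have only one solution on the kept gates; so it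
    suffices to check them for an intended semantics. *)
Lemma eval_prune (a : assignment V) (sem : G -> bool) :
  (forall g, sem g = match lb g with
                     | Const b => b
                     | Lit x b => a x == b
                     | Or => [exists h, r h g && sem h]
                     | And => [forall h, r h g ==> sem h]
                     end) ->
  forall g : gate prune, eval a g = sem (origin g).
Proof.
move=> semE g; have [m] := ubnP (rank (origin g)); elim: m g => // m IHm g lt_m.
have IH (h : gate prune) : r (origin h) (origin g) -> eval a h = sem (origin h).
  by move=> hg; apply: IHm; apply: leq_trans (rank_lt hg) _.
rewrite evalE semE lab_prune; case: (lb (origin g)) => //.
  apply/existsP/existsP=> [[h /andP[hg eh]] | [h /andP[hg sh]]].
    by rewrite arc_prune in hg; exists (origin h); rewrite hg -IH.
  have [h' def_h] := origin_pred hg; rewrite -def_h in hg sh.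
  by exists h'; rewrite arc_prune IH ?hg.
apply/forallP/forallP=> H h; apply/implyP=> hg.
  have [h' def_h] := origin_pred hg; rewrite -def_h in hg *.
  by have := H h'; rewrite arc_prune hg IH.
by rewrite IH //; have := H (origin h); rewrite -arc_prune hg.
Qed.

End Prune.

(** * Subtrees, linear vtrees and the variables read by an SDD *)

Section Vtree.
Variable V : finType.
Implicit Types (S T : vtree V).

Lemma subtree_refl T : subtree T T.
Proof. by case: T => [x|l r]; left. Qed.

Lemma subtree_trans S U T : subtree S U -> subtree U T -> subtree S T.
Proof.
move=> SU; elim: T => [x|l IHl r IHr] /=.
  by case=> // eqU; rewrite eqU in SU.
by case=> [eqU|[/IHl | /IHr]]; [rewrite eqU in SU | tauto | tauto].
Qed.

Lemma subtree_leaves S T : subtree S T -> {subset leaves S <= leaves T}.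
Proof.
elim: T => [x|l IHl r IHr] /=; first by case=> // ->.
by case=> [-> //|[/IHl | /IHr] sub] y /sub; rewrite mem_cat => -> //=;
  rewrite orbT.
Qed.

Lemma sdd_at_subtree (C : circuit V) c S T (g : gate C) :
  subtree S T -> sdd_at c S g -> sdd_at c T g.
Proof.
move=> ST Sg; case: Sg ST => {}S {}g.
- by move=> x b lg xS ST; apply: (SddLit _ lg); apply: subtree_leaves xS.
- by move=> b lg _; apply: SddConst lg.
move=> l r p s tl tr lrS dec tl_l tr_r sddp sdds cs ST.
exact: (SddDec (subtree_trans lrS ST) dec tl_l tr_r sddp sdds cs).
Qed.

Definition chain (l : seq V) (d : V) : vtree V :=
  foldr (fun x T => VNode (VLeaf x) T) (VLeaf d) l.

Lemma leaves_chain l d : leaves (chain l d) = rcons l d.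
Proof. by elim: l => //= x l ->. Qed.

Lemma right_linear_chain l d : right_linear (chain l d).
Proof. by elim: l. Qed.

Lemma sdd_at_dep (C : circuit V) c T (g : gate C) (a a' : assignment V) :
  sdd_at c T g -> {in leaves T, a =1 a'} -> eval a g = eval a' g.
Proof.
move=> sddg; elim: sddg => {T g} [T g x b lg xT|T g b lg|] aa'.
- by rewrite !evalE lg aa'.
- by rewrite !evalE lg.
move=> g l r p s tl tr lrT dec tl_l tr_r _ IHp _ IHs _ eqa.
rewrite !evalE (dec_or dec); apply: eq_existsb => h.
case hg: (arc h g) => //=.
rewrite !evalE (dec_and dec hg); apply: eq_forallb => k.
rewrite (dec_wires dec hg) !inE.
have sub S U : subtree S U -> subtree U (VNode l r) -> {in leaves S, a =1 a'}.
  move=> SU Ulr x xS; apply: eqa.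
  exact: (subtree_leaves lrT (subtree_leaves Ulr (subtree_leaves SU xS))).
case: eqP => [->|_] /=.
  by rewrite (IHp _ hg) //; apply: sub (tl_l _ hg) _ => /=; right; left;
    apply: subtree_refl.
case: eqP => [->|_] //=.
by rewrite (IHs _ hg) //; apply: sub (tr_r _ hg) _ => /=; right; right;
  apply: subtree_refl.
Qed.

End Vtree.

(** * Cofactors and essential variables *)

Section Cofactor.
Variable n : nat.
Implicit Types (F : boolfun n) (a : assignment 'I_n) (x y : 'I_n) (b : bool).

Definition upd a x b : assignment 'I_n := [ffun y => if y == x then b else a y].
Definition bcofactor F x b : boolfun n := [ffun a => F (upd a x b)].
Definition depends F x := [exists a, F (upd a x true) != F (upd a x false)].
(** The variable tested at the root of the reduced OBDD of [F] for the order of indices; [None]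
    stands for a constant [F]. *)
Definition top_var F : option 'I_n :=
  [pick x | depends F x && [forall y, depends F y ==> (x <= y)]].

Lemma upd_id a x : upd a x (a x) = a.
Proof. by apply/ffunP=> y; rewrite ffunE; case: eqP => // ->. Qed.

Lemma upd_upd a x b b' : upd (upd a x b) x b' = upd a x b'.
Proof. by apply/ffunP=> y; rewrite !ffunE; case: eqP. Qed.

Lemma updC a x y b b' :
  x != y -> upd (upd a x b) y b' = upd (upd a y b') x b.
Proof.
move=> neq; apply/ffunP=> z; rewrite !ffunE.
by case: (z =P y) => // ->; rewrite eq_sym (negPf neq).
Qed.

Lemma dependsPn F x : reflect (forall a b,
  F (upd a x b) = F a) (~~ depends F x).
Proof.
rewrite negb_exists; apply: (iffP forallP) => [H a b | H a]; last first.
  by rewrite !H eqxx.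
have /negPn/eqP eqF := H a; rewrite -[in RHS](upd_id a x).
by case: b (a x) => [] [].
Qed.

Lemma bcofactorE F x a : F a = bcofactor F x (a x) a.
Proof. by rewrite ffunE upd_id. Qed.

Lemma depends_bcofactor F x b y :
  depends (bcofactor F x b) y -> (y != x) && depends F y.
Proof.
case/existsP=> a; rewrite !ffunE.
have [->|neq] := eqVneq y x; first by rewrite !upd_upd eqxx.
by rewrite updC // (updC _ _ _ neq) => H; apply/existsP; eexists; apply: H.
Qed.

Lemma bcofactor_neq F x : depends F x ->
  exists a, bcofactor F x true a != bcofactor F x false a.
Proof. by case/existsP=> a H; exists a; rewrite !ffunE. Qed.

Lemma bcofactor_indep F x b : ~~ depends F x -> bcofactor F x b = F.
Proof. by move/dependsPn=> H; apply/ffunP=> a; rewrite ffunE H. Qed.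

(** Overwrite [a] by [a'] one variable at a time: each step either changes an inessential variable
    or changes nothing. *)
Lemma eq_depends F a a' :
  (forall x, depends F x -> a x = a' x) -> F a = F a'.
Proof.
move=> eqa.
have H (s : seq 'I_n) : F a = F [ffun x => if x \in s then a' x else a x].
  elim: s => [|x s ->]; first by congr (F _); apply/ffunP=> x; rewrite ffunE.
  set c := [ffun _ => _].
  have -> : [ffun y => if y \in x :: s then a' y else a y] =
    upd c x (a' x) :> assignment _.
    by apply/ffunP=> y; rewrite !ffunE inE; case: eqP => [->|].
  case dx: (depends F x); last by rewrite (elimT (dependsPn _ _)) ?dx.
  rewrite -{1}(upd_id c x); congr (F (upd _ _ _)).
  by rewrite ffunE eqa // if_same.
rewrite (H (enum 'I_n)); congr (F _); apply/ffunP=> x.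
by rewrite ffunE mem_enum.
Qed.

Lemma top_varP F :
  if top_var F is Some x then depends F x /\ (forall y, depends F y -> x <= y)
  else forall a a', F a = F a'.
Proof.
rewrite /top_var; case: pickP => [x /andP[dx /forallP le_x]|no_top].
  by split=> // y; apply/implyP.
move=> a a'; apply: eq_depends => x dx; exfalso.
have := no_top [arg min_(y < x | depends F y) y].
case: arg_minnP => // y dy le_y; rewrite dy /=.
by move/negP; apply; apply/forallP=> z; apply/implyP; apply: le_y.
Qed.

Lemma top_var_Some F x : top_var F = Some x -> depends F x.
Proof. by move=> Fx; have := top_varP F; rewrite Fx; case. Qed.

Definition ndeps F := #|[pred x | depends F x]|.

Lemma ndeps_bcofactor F x b : depends F x -> ndeps (bcofactor F x b) < ndeps F.
Proof.
move=> dx; apply/proper_card/properP; split.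
  by apply/subsetP=> y; rewrite !inE => /depends_bcofactor/andP[].
exists x; rewrite ?inE //; apply/negP=> /depends_bcofactor.
by rewrite eqxx.
Qed.

End Cofactor.

(** * A decision over literals whose primes are shared reduced OBDDs *)

Section DecisionCircuit.
Variables (n : nat) (J : finType) (prime : J -> boolfun n) (sub : J ->
  'I_n * bool).
Implicit Types (F : boolfun n) (a : assignment 'I_n).

(** Indexing [FunG] by functions merges equivalent gates, as in a reduced OBDD. [AndG F b] is the
    branch of [F] where its top variable is [b]; [RootG] is the single large decision and
    [RootAndG j] its branch with prime [prime j] and literal [sub j]. *)
Inductive dgate :=
  LitG of 'I_n & bool | FunG of boolfun n | AndG of boolfun n & bool
| RootAndG of J | RootG.

Definition dgate_code (g : dgate) :
    'I_n * bool + boolfun n + boolfun n * bool + option J :=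
  match g with
  | LitG x b => inl (inl (inl (x, b)))
  | FunG F => inl (inl (inr F))
  | AndG F b => inl (inr (F, b))
  | RootAndG j => inr (Some j)
  | RootG => inr None
  end.

Definition dgate_decode c : dgate :=
  match c with
  | inl (inl (inl (x, b))) => LitG x b
  | inl (inl (inr F)) => FunG F
  | inl (inr (F, b)) => AndG F b
  | inr (Some j) => RootAndG j
  | inr None => RootG
  end.

Lemma dgate_codeK : cancel dgate_code dgate_decode.
Proof. by case. Qed.

HB.instance Definition _ := Finite.copy dgate (can_type dgate_codeK).

Definition sat (j : J) := [exists a, prime j a].

Definition darc : rel dgate := fun h g =>
  match g, h with
  | FunG F, AndG F' _ => (F' == F) && isSome (top_var F)
  | AndG F b, LitG x c => (top_var F == Some x) && (c == b)
  | AndG F b, FunG F' =>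
      if top_var F is Some x then F' == bcofactor F x b else false
  | RootAndG j, FunG F => F == prime j
  | RootAndG j, LitG x b => (x, b) == sub j
  | RootG, RootAndG j => sat j
  | _, _ => false
  end.

Definition all_false : assignment 'I_n := [ffun=> false].

(** Exactly the gates without inputs must carry an input label. For [FunG F] this happens when [F]
    is constant, so any point gives its value; the other cases are [AndG] over a constant and a
    [RootG] without satisfiable prime. *)
Definition dlab (g : dgate) : label 'I_n :=
  if [forall h, ~~ darc h g] then
    match g with
    | LitG x b => Lit x b | FunG F => Const (F all_false) | _ => Const false
    end
  else match g with FunG _ | RootG => Or | _ => And end.

(** Doubling leaves room for [AndG F b] strictly between [FunG F] and its cofactor, which has fewer
    essential variables. *)
Definition drank (g : dgate) : nat :=
  match g with
  | LitG _ _ => 0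
  | FunG F => (ndeps F).*2.+1
  | AndG F _ => (ndeps F).*2
  | RootAndG _ => n.*2.+2
  | RootG => n.*2.+3
  end.

Lemma drank_lt h g : darc h g -> drank h < drank g.
Proof.
have ndeps_gt0 F x : depends F x -> 0 < ndeps F.
  by move=> dx; apply/card_gt0P; exists x.
have ndeps_le F : ndeps F <= n by rewrite -[n in _ <= n]card_ord max_card.
case: g h => [x b|F|F b|j|] [y c|F'|F' c|j'|] //=.
- by case/andP=> /eqP->.
- by case/andP=> /eqP/top_var_Some/ndeps_gt0; lia.
- case Fx: top_var => [x|] // /eqP->.
  by have := ndeps_bcofactor b (top_var_Some Fx); lia.
- by have := ndeps_le F'; lia.
Qed.

Lemma dlab_input g : input_label (dlab g) = [forall h, ~~ darc h g].
Proof. by rewrite /dlab; case: ifP; case: g. Qed.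

Lemma dlabP h g : darc h g ->
  dlab g = match g with FunG _ | RootG => Or | _ => And end.
Proof.
by move=> hg; rewrite /dlab; case: forallP => // /(_ h); rewrite hg.
Qed.

Definition dsem a (g : dgate) : bool :=
  match g with
  | LitG x b => a x == b
  | FunG F => F a
  | AndG F b =>
      if top_var F is Some x then (a x == b) && bcofactor F x b a else false
  | RootAndG j => prime j a && (a (sub j).1 == (sub j).2)
  | RootG => [exists j, prime j a && (a (sub j).1 == (sub j).2)]
  end.

Lemma darc_and F x b h : top_var F = Some x ->
  darc h (AndG F b) = (h \in [set LitG x b; FunG (bcofactor F x b)]).
Proof.
move=> Fx; rewrite !inE; case: h => [y c|F'|F' c|j|] //=; rewrite ?orbF ?Fx //.
by apply/andP/eqP => [[/eqP[->] /eqP->]|[-> ->]].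
Qed.

Lemma darc_root_and j h :
  darc h (RootAndG j) = (h \in [set FunG (prime j); LitG (sub j).1 (sub j).2]).
Proof.
by rewrite !inE; case: h => [y c|F'|F' c|j'|] //=; rewrite orbF.
Qed.

(** At [FunG F] this is the Shannon expansion on the top variable. At [RootG], omitting the
    unsatisfiable primes does not change the disjunction. *)
Lemma dsemE a g :
  dsem a g = match dlab g with
             | Const b => b
             | Lit x b => a x == b
             | Or => [exists h, darc h g && dsem a h]
             | And => [forall h, darc h g ==> dsem a h]
             end.
Proof.
case: g => [x b|F|F b|j|].
- by rewrite /dlab ifT //; apply/forallP; case.
- have := top_varP F; case Fx: (top_var F) => [x|]; last first.
    move=> cF; rewrite /dlab ifT //=; apply/forallP.
    by case=> //= F' c; rewrite Fx andbF.
  case=> dx _; rewrite (@dlabP (AndG F true)) /= ?eqxx ?Fx //.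
  rewrite (bcofactorE F x a); apply/idP/existsP => [H|[[] //= F' c]].
    by exists (AndG F (a x)); rewrite /= Fx !eqxx.
  by case/andP=> /andP[/eqP-> _]; rewrite Fx => /andP[/eqP->].
- case Fx: (top_var F) => [x|]; last first.
    rewrite /dlab ifT /= ?Fx //; apply/forallP; case=> //= *; by rewrite Fx.
  rewrite (@dlabP (LitG x b)); last by rewrite (darc_and _ _ Fx) set21.
  rewrite -[RHS]/[forall h, darc h (AndG F b) ==> dsem a h] [LHS]/= Fx.
  apply/andP/forallP => [[xb Fb] h | H].
    apply/implyP; rewrite (darc_and _ _ Fx).
    by rewrite !inE => /orP[]/eqP->.
  have := H (LitG x b); have := H (FunG (bcofactor F x b)).
  by rewrite !(darc_and _ _ Fx) set21 set22.
- rewrite (@dlabP (FunG (prime j))); last by rewrite darc_root_and set21.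
  rewrite -[RHS]/[forall h, darc h (RootAndG j) ==> dsem a h] [LHS]/=.
  apply/andP/forallP => [[pj sj] h|H].
    apply/implyP; rewrite darc_root_and !inE.
    by case/orP=> /eqP->.
  have := H (FunG (prime j)); have := H (LitG (sub j).1 (sub j).2).
  by rewrite !darc_root_and set21 set22.
rewrite /dlab; case: ifPn => [/forallP H|_].
  apply/existsP=> -[j /andP[pj _]]; have /negP := H (RootAndG j).
  by apply; apply/existsP; exists a.
apply/existsP/existsP => [[j pj]|[[] //= j /andP[_ pj]]]; last by exists j.
exists (RootAndG j); rewrite /= pj andbT; apply/existsP; exists a.
by case/andP: pj.
Qed.

Definition dcircuit (root : dgate) : circuit 'I_n :=
  prune root drank_lt dlab_input.

Lemma eval_dcircuit root a (g : gate (dcircuit root)) :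
  eval a g = dsem a (origin g).
Proof. exact: eval_prune (dsemE a) g. Qed.

End DecisionCircuit.

(** * The decision circuits are compressed SDDs *)

Section SddOfDecisionCircuit.
Variables (n : nat) (J : finType) (prime : J -> boolfun n) (sub : J ->
  'I_n * bool).
Variable root : dgate n J.
Let C := dcircuit prime sub root.
Implicit Types (F : boolfun n) (a : assignment 'I_n) (g h : gate C).

Lemma arc_fun F g h : origin g = FunG J F -> arc h g ->
  exists b, origin h = AndG J F b.
Proof.
rewrite arc_prune => ->; case: (origin h) => //= F' b /andP[/eqP-> _].
by exists b.
Qed.

Lemma arc_root g h : origin g = RootG n J -> arc h g ->
  exists2 j, origin h = RootAndG n j & sat prime j.
Proof. by rewrite arc_prune => ->; case: (origin h) => //= j; exists j. Qed.

Lemma pred_fun F x g b : origin g = FunG J F -> top_var F = Some x ->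
  exists2 h, arc h g & origin h = AndG J F b.
Proof.
move=> gF Fx; have Fg: darc prime sub (AndG J F b) (origin g).
  by rewrite gF /= Fx eqxx.
by have [h def_h] := origin_pred Fg; exists h; rewrite // arc_prune def_h.
Qed.

Lemma pred_root j g : origin g = RootG n J -> sat prime j ->
  exists2 h, arc h g & origin h = RootAndG n j.
Proof.
move=> gR sj; have Rg: darc prime sub (RootAndG n j) (origin g) by rewrite gR.
by have [h def_h] := origin_pred Rg; exists h; rewrite // arc_prune def_h.
Qed.

Lemma lab_dcircuit g h : arc h g ->
  lab g = match origin g with FunG _ | RootG => Or | _ => And end.
Proof. by rewrite arc_prune => /dlabP <-. Qed.

Lemma lab_lit x b g : origin g = LitG J x b -> lab g = Lit x b.
Proof. by rewrite lab_prune => ->; rewrite /dlab ifT //; apply/forallP;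
  case. Qed.

Lemma sdd_const T F g : origin g = FunG J F -> top_var F = None ->
  sdd_at true T g.
Proof.
move=> gF Fx; apply: (@SddConst _ _ _ _ _ (F (all_false n))).
rewrite lab_prune gF /dlab ifT //; apply/forallP.
by case=> //= F' b; rewrite Fx andbF.
Qed.

Definition fun_prime x (u : dgate n J) :=
  if u is AndG _ b then LitG J x b else u.
Definition fun_sub x (u : dgate n J) :=
  if u is AndG F b then FunG J (bcofactor F x b) else u.
Definition root_prime (u : dgate n J) :=
  if u is RootAndG j then FunG J (prime j) else u.
Definition root_sub (u : dgate n J) :=
  if u is RootAndG j then LitG J (sub j).1 (sub j).2 else u.

Lemma origin_fun F x b h : origin h = AndG J F b -> top_var F = Some x ->
  origin (lift_pred (fun_prime x) h) = LitG J x b /\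
  origin (lift_pred (fun_sub x) h) = FunG J (bcofactor F x b).
Proof.
by move=> hF Fx; split;
  rewrite origin_lift hF // (darc_and _ _ _ _ Fx) ?set21 ?set22.
Qed.

Lemma origin_root j h : origin h = RootAndG n j ->
  origin (lift_pred root_prime h) = FunG J (prime j) /\
  origin (lift_pred root_sub h) = LitG J (sub j).1 (sub j).2.
Proof.
by move=> hj; split; rewrite origin_lift hj // darc_root_and ?set21 ?set22.
Qed.

Lemma decision_fun F x g : origin g = FunG J F -> top_var F = Some x ->
  decision g (lift_pred (fun_prime x)) (lift_pred (fun_sub x)).
Proof.
move=> gF Fx; have [h1 h1g h1F] := pred_fun true gF Fx.
have [h0 h0g h0F] := pred_fun false gF Fx.
split=> [||h hg|h hg k|h hg|h h' hg h'g hh' a|a].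
- by rewrite (lab_dcircuit h1g) gF.
- apply/card_gt1P; exists h1, h0; rewrite !inE h1g h0g; split=> //.
  by apply/eqP=> h10; move: h1F; rewrite h10 h0F.
- have [b hF] := arc_fun gF hg; rewrite lab_prune hF.
  by rewrite (@dlabP _ _ _ _ (LitG J x b)) // (darc_and _ _ _ _ Fx) set21.
- have [b hF] := arc_fun gF hg; have [pF sF] := origin_fun hF Fx.
  rewrite arc_prune hF (darc_and _ _ _ _ Fx) !inE -pF -sF.
  by rewrite !(inj_eq (@origin_inj _ _ _ _ _ _ _ _)).
- have [b hF] := arc_fun gF hg; have [pF _] := origin_fun hF Fx.
  by exists [ffun=> b]; rewrite eval_dcircuit pF /= ffunE.
- have [b hF] := arc_fun gF hg; have [pF _] := origin_fun hF Fx.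
  have [b' hF'] := arc_fun gF h'g; have [pF' _] := origin_fun hF' Fx.
  rewrite !eval_dcircuit pF pF' /=;
    apply: contra hh' => /andP[/eqP eqb /eqP eqb'].
  by apply/eqP/origin_inj; rewrite hF hF' -eqb -eqb'.
- have [h hg hF] := pred_fun (a x) gF Fx; exists h => //.
  by have [pF _] := origin_fun hF Fx; rewrite eval_dcircuit pF /= eqxx.
Qed.

(** Induction along the chain. At the top variable, [FunG F] is a decision whose primes are the two
    literals and whose subs are the two cofactors; these differ because the variable is essential,
    which gives compression. *)
Lemma sdd_chain l d F g : origin g = FunG J F ->
  pairwise (fun x y : 'I_n => x < y) l -> (forall x, depends F x -> x \in l) ->
  sdd_at true (chain l d) g.
Proof.
elim: l F g => [|y l IHl] F g gF /=; case Fx: (top_var F) => [x|].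
- by move=> _ /(_ x (top_var_Some Fx)).
- by move=> _ _; apply: sdd_const Fx.
- case/andP=> lt_y sl dFl; have := top_varP F; rewrite Fx => -[x_dep x_min].
  (* If [y] is not the least essential variable [x], then [y < x] is inessential and the chain below
     [y] already suffices. *)
  have [eq_xy | neq_xy] := eqVneq x y; last first.
    apply: (@sdd_at_subtree _ _ _ (chain l d)); first by right; right;
      apply: subtree_refl.
    apply: IHl gF sl _ => z dz; have := dFl z dz;
      rewrite inE => /orP[/eqP eq_zy|//].
    have:= dFl x x_dep; rewrite inE (negPf neq_xy) /= => /(allP lt_y).
    by rewrite ltnNge -eq_zy x_min.
  subst y.
  apply: (@SddDec _ _ _ _ _ (VLeaf x) (chain l d) _ _ (fun=> VLeaf x) (fun=>
    chain l d)
    _ (decision_fun gF Fx)).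
  + exact: subtree_refl.
  + by move=> *; apply: subtree_refl.
  + by move=> *; apply: subtree_refl.
  + move=> h hg; have [b hF] := arc_fun gF hg; have [pF _] := origin_fun hF Fx.
    by apply: SddLit (lab_lit pF) _; apply: mem_head.
  + move=> h hg; have [b hF] := arc_fun gF hg; have [_ sF] := origin_fun hF Fx.
    apply: IHl sF sl _ => z /depends_bcofactor/andP[zx /dFl].
    by rewrite inE (negPf zx).
  + move=> _ h h' hg h'g hh'.
    have [b hF] := arc_fun gF hg; have [_ sF] := origin_fun hF Fx.
    have [b' hF'] := arc_fun gF h'g; have [_ sF'] := origin_fun hF' Fx.
    have neqb: b != b'.
      by apply: contra_neq hh' => eqb; apply: origin_inj; rewrite hF hF' eqb.
    have [a neqa] := bcofactor_neq x_dep; exists a.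
    rewrite !eval_dcircuit sF sF' /=.
    by case: b b' neqb {hF hF' sF sF'} => [] [] // _; rewrite eq_sym.
by move=> _ _; apply: sdd_const Fx.
Qed.

Hypothesis prime_disjoint : forall j j' a, prime j a -> prime j' a -> j = j'.
Hypothesis prime_cover : forall a, exists j, prime j a.
Hypothesis sat_gt1 : exists j j', [/\ sat prime j, sat prime j' & j != j'].
Hypothesis sub_inj : injective sub.

Lemma decision_root g : origin g = RootG n J ->
  decision g (lift_pred root_prime) (lift_pred root_sub).
Proof.
move=> gR; have [j1 [j2 [sat1 sat2 neqj]]] := sat_gt1.
have [h1 h1g h1F] := pred_root gR sat1.
have [h2 h2g h2F] := pred_root gR sat2.
split=> [||h hg|h hg k|h hg|h h' hg h'g hh' a|a].
- by rewrite (lab_dcircuit h1g) gR.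
- apply/card_gt1P; exists h1, h2; rewrite !inE h1g h2g; split=> //.
  by apply/eqP=> h12; move: h1F neqj; rewrite h12 h2F => -[->]; rewrite eqxx.
- have [j hj _] := arc_root gR hg; rewrite lab_prune hj.
  by rewrite (@dlabP _ _ _ _ (FunG J (prime j))) // darc_root_and set21.
- have [j hj _] := arc_root gR hg; have [pj sj] := origin_root hj.
  rewrite arc_prune hj darc_root_and !inE -pj -sj.
  by rewrite !(inj_eq (@origin_inj _ _ _ _ _ _ _ _)).
- have [j hj /existsP[a pa]] := arc_root gR hg; have [pj _] := origin_root hj.
  by exists a; rewrite eval_dcircuit pj.
- have [j hj _] := arc_root gR hg; have [pj _] := origin_root hj.
  have [j' hj' _] := arc_root gR h'g; have [pj' _] := origin_root hj'.
  rewrite !eval_dcircuit pj pj' /=; apply: contra hh' => /andP[Pj Pj'].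
  by apply/eqP/origin_inj; rewrite hj hj' (prime_disjoint Pj Pj').
- have [j pja] := prime_cover a; have satj: sat prime j by apply/existsP;
  exists a.
  have [h hg hj] := pred_root gR satj; exists h => //.
  by have [pj _] := origin_root hj; rewrite eval_dcircuit pj.
Qed.

Lemma literal_neq (u v : 'I_n * bool) : u != v ->
  exists a, (a u.1 == u.2) != (a v.1 == v.2).
Proof.
(* This assignment satisfies the first literal and falsifies the second, also when both are on the
   same variable. *)
case: u v => [x b] [y c] /= neq; exists [ffun z => if z == x then b else ~~ c].
rewrite !ffunE !eqxx; have [eq_yx|_] := eqVneq y x; last by case: (c).
by apply/eqP=> /esym/eqP eq_bc; rewrite eq_yx eq_bc eqxx in neq.
Qed.

(** The primes live on the chain and the literal subs on [R]. Compression holds because [sub] is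
    injective and distinct literals are inequivalent. *)
Lemma sdd_root l d R g : origin g = RootG n J ->
  pairwise (fun x y : 'I_n => x < y) l ->
  (forall j x, depends (prime j) x -> x \in l) ->
  (forall j, (sub j).1 \in leaves R) ->
  sdd_at true (VNode (chain l d) R) g.
Proof.
move=> gR sl prime_l sub_R.
apply: (@SddDec _ _ _ _ _ (chain l d) R _ _ (fun=> chain l d) (fun=> R)
  _ (decision_root gR)).
- exact: subtree_refl.
- by move=> *; apply: subtree_refl.
- by move=> *; apply: subtree_refl.
- move=> h hg; have [j hj _] := arc_root gR hg; have [pj _] := origin_root hj.
  exact: sdd_chain pj sl (prime_l j).
- move=> h hg; have [j hj _] := arc_root gR hg; have [_ sj] := origin_root hj.
  by apply: SddLit (lab_lit sj) _; apply: sub_R.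
move=> _ h h' hg h'g hh'.
have [j hj _] := arc_root gR hg; have [_ sj] := origin_root hj.
have [j' hj' _] := arc_root gR h'g; have [_ sj'] := origin_root hj'.
have neqj: sub j != sub j'.
  apply: contra_neq hh' => /sub_inj eqj; apply: origin_inj.
  by rewrite hj hj' eqj.
by have [a neqa] := literal_neq neqj; exists a; rewrite !eval_dcircuit sj sj'.
Qed.

End SddOfDecisionCircuit.

(** * Counting the arcs of decision circuits *)

Section SizeOfDecisionCircuit.
Variables (n : nat) (J : finType) (prime : J -> boolfun n) (sub : J ->
  'I_n * bool).
Variable S : {set boolfun n}.
Hypothesis prime_S : forall j, prime j \in S.
Hypothesis bcofactor_S : forall F x b,
  F \in S -> top_var F = Some x -> bcofactor F x b \in S.

(** Codes for the three arcs at the branch [b] of [F]: its two inputs and its output. For a constant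
    [F] the pair is not an arc, which is harmless for an upper bound. *)
Definition fun_arc (u : boolfun n * bool * option bool) :
  dgate n J * dgate n J :=
  let: (F, b, i) := u in
  match top_var F, i with
  | Some x, Some true => (LitG J x b, AndG J F b)
  | Some x, Some false => (FunG J (bcofactor F x b), AndG J F b)
  | _, _ => (AndG J F b, FunG J F)
  end.

Definition root_arc (u : J * option bool) : dgate n J * dgate n J :=
  let: (j, i) := u in
  match i with
  | Some true => (FunG J (prime j), RootAndG n j)
  | Some false => (LitG J (sub j).1 (sub j).2, RootAndG n j)
  | None => (RootAndG n j, RootG n J)
  end.

Definition fun_in (g : dgate n J) : bool :=
  match g with FunG F => F \in S | AndG F _ => F \in S | _ => true end.

Lemma fun_in_arc h g : darc prime sub h g -> fun_in g -> fun_in h.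
Proof.
case: g h => [x b|F|F b|j|] [y c|F'|F' c|j'|] //=.
- by case/andP=> /eqP->.
- by case Fx: top_var => [x|] // /eqP-> FS; apply: bcofactor_S.
- by move/eqP->.
Qed.

Lemma fun_in_connect h : connect (darc prime sub) h (RootG n J) -> fun_in h.
Proof.
case/connectP=> p; elim: p h => [|k p IHp] h /=; first by move=> _ <-.
by case/andP=> hk kp def_r; apply: fun_in_arc hk (IHp _ kp def_r).
Qed.

(** As [S] contains the primes and is closed under top cofactors, all reachable functions lie in it.
    Each has two branches with three arcs, and each branch of the root has three arcs. *)
Lemma size_dcircuit :
  size_circuit (dcircuit prime sub (RootG n J)) <= 6 * #|S| + 3 * #|J|.
Proof.
set C := dcircuit _ _ _; rewrite /size_circuit; set A := [set e | _].
pose o (e : gate C * gate C) := (origin e.1, origin e.2).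
have o_inj : injective o.
  by move=> [h g] [h' g'] [] /origin_inj-> /origin_inj->.
rewrite -(card_imset _ o_inj).
have sub_A : [set o e | e in A] \subset
    (fun_arc @: setX (setX S setT) setT) :|: (root_arc @: setT).
  apply/subsetP=> _ /imsetP[e + ->]; rewrite inE arc_prune /o.
  move: e.1 e.2 => h g hg.
  have g_in : fun_in (origin g) by apply: fun_in_connect (valP (g :
    reach_gate _ _)).
  rewrite inE; case: (origin g) (origin h) hg g_in =>
    [x b|F|F b|j|] [y c|F'|F' c|j'|] //=.
  - case/andP=> /eqP-> FS FinS; apply/orP; left; apply/imsetP.
    by exists (F, c, None); rewrite ?inE ?FinS //=; case: top_var.
  - case/andP=> /eqP Fy /eqP-> FinS; apply/orP; left; apply/imsetP.
    by exists (F, b, Some true); rewrite ?inE ?FinS //= Fy.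
  - case Fx: top_var => [x|] // /eqP-> FinS; apply/orP; left; apply/imsetP.
    by exists (F, b, Some false); rewrite ?inE ?FinS //= Fx.
  - move=> /eqP subj _; apply/orP; right; apply/imsetP.
    by exists (j, Some false); rewrite ?inE //= -subj.
  - move=> /eqP-> _; apply/orP; right; apply/imsetP.
    by exists (j, Some true); rewrite ?inE.
  - move=> _ _; apply/orP; right; apply/imsetP.
    by exists (j', None); rewrite ?inE.
apply: leq_trans (subset_leq_card sub_A) _.
apply: leq_trans (leq_card_setU _ _) _; apply: leq_add.
  apply: leq_trans (leq_imset_card _ _) _.
  by rewrite !cardsX !cardsT card_option card_bool -mulnA mulnC.
apply: leq_trans (leq_imset_card _ _) _.
by rewrite cardsT card_prod card_option card_bool mulnC.
Qed.

End SizeOfDecisionCircuit.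

(** * Reading a prefix of the variables in a right-linear SDD *)

Section RightLinear.
Variables (V : finType) (C : circuit V).
Implicit Types (T : vtree V) (g h : gate C) (a : assignment V).

Lemma sdd_at_leaf_var c x g : sdd_at c (VLeaf x) g ->
  forall a a', a x = a' x -> eval a g = eval a' g.
Proof. by move=> xg a a' aa'; apply: sdd_at_dep xg _ => y;
  rewrite inE => /eqP->. Qed.

(** The primes depend on [x] only, so fixing [x] makes exactly one prime true, and the decision
    reduces to the corresponding sub. *)
Lemma decision_step c x r g p s tl tr :
  decision g p s ->
  (forall h, arc h g -> subtree (tl h) (VLeaf x)) ->
  (forall h, arc h g -> subtree (tr h) r) ->
  (forall h, arc h g -> sdd_at c (tl h) (p h)) ->
  (forall h, arc h g -> sdd_at c (tr h) (s h)) ->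
  forall b, exists2 k : gate C, sdd_at c r k & forall a, a x = b ->
    eval a g = eval a k.
Proof.
move=> dec tl_x tr_r sdd_p sdd_s b.
have [h hg ph] := dec_cover dec [ffun=> b].
have px h' : arc h' g -> forall a a', a x = a' x ->
  eval a (p h') = eval a' (p h').
  move=> h'g; apply: sdd_at_leaf_var.
  exact: sdd_at_subtree (tl_x _ h'g) (sdd_p _ h'g).
exists (s h); first exact: sdd_at_subtree (tr_r _ hg) (sdd_s _ hg).
move=> a axb; have ph_a : eval a (p h) by rewrite (px _ hg _ [ffun=> b]) ?ffunE.
have eval_h h' : arc h' g -> eval a h' = eval a (p h') && eval a (s h').
  move=> h'g; rewrite evalE (dec_and dec h'g).
  apply/forallP/andP => [H | [eP eS] k].
    by split; [have := H (p h') | have := H (s h')];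
      rewrite (dec_wires dec h'g) !inE eqxx ?orbT.
  by apply/implyP; rewrite (dec_wires dec h'g) !inE => /orP[]/eqP->.
rewrite evalE (dec_or dec); apply/existsP/idP => [[h' /andP[h'g]]|sh].
  rewrite eval_h // => /andP[ph'_a].
  have [->//|neq] := eqVneq h' h.
  by have := dec_disjoint dec h'g hg neq a; rewrite ph'_a ph_a.
by exists h; rewrite hg eval_h ?ph_a.
Qed.

(** The left child is a leaf, so a decision sits either at the root, where [decision_step] applies,
    or inside [r]. *)
Lemma right_linear_sdd_cases c x r g : right_linear r -> 
  sdd_at c (VNode (VLeaf x) r) g ->
  [\/ exists b, lab g = Lit x b, sdd_at c r g |
   forall b, exists2 k : gate C, sdd_at c r k & forall a, a x = b ->
     eval a g = eval a k].
Proof.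
move=> rl_r; move def_T: (VNode _ _) => T Tg; case: Tg def_T => {T g}.
- move=> T g y b lg + defT; rewrite -defT inE /= => /orP[/eqP eq_yx|yr].
    by constructor 1; exists b; rewrite -eq_yx.
  by constructor 2; apply: SddLit lg yr.
- by move=> T g b lg _; constructor 2; apply: SddConst lg.
move=> T g l r' p s tl tr + dec tl_l tr_r sdd_p sdd_s cs defT; rewrite -defT.
case=> [[eq_l eq_r]|[[]//|sub_r]].
  subst; constructor 3; exact: decision_step dec tl_l tr_r sdd_p sdd_s.
by constructor 2; apply: SddDec sub_r dec tl_l tr_r sdd_p sdd_s cs.
Qed.

Definition sink_eval a (u : gate C + bool) : bool :=
  match u with inl g => eval a g | inr b => b end.

(* Reading the variables [s1] of a right-linear vtree leads from [g] to a gate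
   which only depends on the remaining variables [s2]; a literal on a variable
   of [s1] has no such gate, whence the extra constants. *)
Lemma right_linear_prefix c T g (s1 s2 : seq V) a0 :
  right_linear T -> sdd_at c T g -> leaves T = s1 ++ s2 ->
  exists2 u : gate C + bool,
    (forall a, {in s1, a =1 a0} -> eval a g = sink_eval a u) &
    (forall a a', {in s2, a =1 a'} -> sink_eval a u = sink_eval a' u).
Proof.
elim: T g s1 => [x|l _ r IHr] g [|y s1] /=.
- move=> _ xg <-; exists (inl g) => //= a a' aa'.
  exact: sdd_at_dep xg aa'.
- move=> _ xg [<- _]; exists (inr (eval a0 g)) => //= a aa0.
  by apply: sdd_at_leaf_var xg _ _ _; rewrite aa0 ?mem_head.
- move=> _ Tg <-; exists (inl g) => //= a a' aa'.
  exact: sdd_at_dep Tg aa'.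
case: l => // x rl_r Tg /= [<- defr].
have IH (k : gate C) : sdd_at c r k -> exists2 u : gate C + bool,
    (forall a, {in x :: s1, a =1 a0} -> eval a k = sink_eval a u) &
    (forall a a', {in s2, a =1 a'} -> sink_eval a u = sink_eval a' u).
  move=> rk; have [u u1 u2] := IHr k s1 rl_r rk defr; exists u => // a aa0.
  by apply: u1 => z z_s1; apply: aa0; rewrite inE z_s1 orbT.
case: (right_linear_sdd_cases rl_r Tg) => [[b lg]|/IH//|/(_ (a0 x))[k rk gk]].
  exists (inr (a0 x == b)) => //= a aa0.
  by rewrite evalE lg aa0 ?mem_head.
have [u u1 u2] := IH k rk; exists u => // a aa0.
by rewrite gk ?u1 // aa0 ?mem_head.
Qed.

(** Every gate other than the output has an outgoing wire; choosing one for each is an injection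
    into the arcs. *)
Lemma card_gate_size : #|gate C| <= (size_circuit C).+1.
Proof.
have next g : g != out C -> exists h, arc g h.
  by rewrite out_unique negb_forall => /existsP[h]; rewrite negbK; exists h.
pose nxt g := odflt (out C) [pick h | arc g h].
rewrite (cardD1 (out C)) inE add1n ltnS /size_circuit.
rewrite -(card_in_imset (f := fun g => (g, nxt g))); last by move=> ? ? _ _ [].
apply/subset_leq_card/subsetP=> e /imsetP[g]; rewrite !inE andbT => g_out ->.
rewrite /= /nxt; case: pickP => [//|no_h].
by have [h] := next g g_out; rewrite no_h.
Qed.

End RightLinear.

(** * Elementary counting *)

Lemma exists_subset_card (T : finType) (A : {set T}) m :
  m <= #|A| -> exists2 B : {set T}, B \subset A & #|B| = m.
Proof.
move=> le_m; exists [set x in take m (enum A)].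
  by apply/subsetP=> x; rewrite inE => /mem_take; rewrite mem_enum.
rewrite cardsE (card_uniqP _) ?take_uniq ?enum_uniq //.
by rewrite size_takel // -cardE.
Qed.

(** Lengthening a prefix by one element raises the count by at most one, so no value is skipped. *)
Lemma exists_take_count (T : Type) (p : pred T) (s : seq T) m :
  m <= count p s -> exists k, count p (take k s) = m.
Proof.
elim: s m => [|x s IHs] m /=; first by rewrite leqn0 => /eqP->; exists 0.
case: m => [_|m le_m]; first by exists 0.
have [|k def_k] := IHs (m.+1 - p x); first by lia.
by exists k.+1; rewrite /= def_k; case: (p x) => //=; lia.
Qed.

Lemma card_ord_range N p q : q <= N ->
  #|[set v : 'I_N | p <= v < q]| = q - p.
Proof.
move=> le_qN; rewrite -sum1_card (eq_bigl (fun v : 'I_N => p <= v < q));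
  last first.
  by move=> v; rewrite inE.
rewrite -[RHS]muln1 -sum_nat_const_nat (@big_nat_widenl _ _ _ p 0) //.
by rewrite (big_nat_widen _ _ _ _ _ le_qN) big_mkord.
Qed.

(** * The function, its events and their subfunctions *)

Section HiddenWeightedBit.
Variable n : nat.
Local Notation N := n.*2.+2.
Implicit Types (a : assignment 'I_N) (F : boolfun N).

(** Index layout: [x_i] at [i < n], then [z_c] at [n + c] for [c <= n], then one dummy. [xvar] also
    serves to name a variable by its index in the whole range. *)
Definition xvar (i : nat) : 'I_N := inord i.
Definition zvar (c : nat) : 'I_N := inord (n + c).
Definition weight k a := #|[set v : 'I_N | (k <= v < n) && a v]|.

(* The variable [xvar n.*2.+1] is a dummy last leaf of the vtrees, so that
   every variable on which the function of a gate depends is the left child of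
   an inner node. *)
Definition hwb : boolfun N :=
  [ffun a => let c := weight 0 a in a (zvar c) == (c < n) && a (xvar c)].

(* The subfunctions of [weight 0 a = c /\ x_c = b] after reading
   [x_0, ..., x_(k-1)]; by convention [x_n] is false. *)
Definition bit_at k c i b : boolfun N :=
  [ffun a => (weight k a == c) && ((i < k) || (((i < n) && a (xvar i)) == b))].

Definition hwb_prime (j : 'I_n.+1 * bool) : boolfun N := bit_at 0 j.1 j.1 j.2.
Definition hwb_sub (j : 'I_n.+1 * bool) : 'I_N * bool := (zvar j.1, j.2).

Lemma xvarK i : i < N -> xvar i = i :> nat.
Proof. exact: inordK. Qed.

Lemma zvarK c : c <= n -> zvar c = n + c :> nat.
Proof. by move=> le_c; rewrite inordK //; lia. Qed.

Lemma weight_le k a : weight k a <= n.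
Proof.
apply: leq_trans (subset_leq_card _) _; last first.
  rewrite -[n in _ <= n]subn0 -(@card_ord_range N 0 n) //; lia.
by apply/subsetP=> v; rewrite !inE => /andP[/andP[_ ->]].
Qed.

Lemma weightS k a : k < n -> weight k a = a (xvar k) + weight k.+1 a.
Proof.
move=> lt_k; have xk: xvar k = k :> nat by rewrite xvarK //; lia.
rewrite /weight (cardsD1 (xvar k)) inE xk leqnn lt_k /=; congr (_ + _).
apply: eq_card => v; rewrite !inE -val_eqE /= xk.
by case: (a v); rewrite ?andbF // !andbT; lia.
Qed.

Lemma eq_weight k a a' :
  (forall v : 'I_N, k <= v < n -> a v = a' v) -> weight k a = weight k a'.
Proof.
by move=> eqa; apply: eq_card => v; rewrite !inE; apply: andb_id2l => /eqa ->.
Qed.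

Lemma depends_bit_at k c i b y : depends (bit_at k c i b) y -> k <= y < n.
Proof.
apply: contraLR => ynk; apply/dependsPn => a v; rewrite [LHS]ffunE [RHS]ffunE.
have upd_eq (u : 'I_N) : k <= u < n -> upd a y v u = a u.
  by move=> u_kn; rewrite ffunE; case: eqP => // eq_uy;
    rewrite -eq_uy u_kn in ynk.
rewrite (eq_weight upd_eq); case: (ltnP i k) => //= le_ki.
case: (ltnP i n) => //= lt_i; have xi: xvar i = i :> nat by rewrite xvarK //;
  lia.
by rewrite upd_eq // xi le_ki.
Qed.

(** Setting [x_k] to [v] leaves the weight [c - v] to be reached, impossible if [v > c]. When
    [i = k], the bit test is decided by [v], and it is absent from [bit_at k.+1]. *)
Lemma bcofactor_bit_at k c i b (v : bool) : k < n ->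
  bcofactor (bit_at k c i b) (xvar k) v =
  if (v <= c) && ((i == k) ==> (v == b)) then bit_at k.+1 (c - v) i b
  else [ffun=> false].
Proof.
move=> lt_k; have xk: xvar k = k :> nat by rewrite xvarK //; lia.
apply/ffunP=> a; rewrite ffunE [LHS]ffunE weightS // [upd _ _ _ _]ffunE eqxx.
rewrite (@eq_weight _ _ a); last first.
  by move=> u u_kn; rewrite ffunE; case: eqP => // eq_u;
    rewrite eq_u xk in u_kn; lia.
have [->|neq_ik] := eqVneq i k.
  rewrite ltnn lt_k /= ffunE eqxx.
  case: ifP => [/andP[le_v ->]|]; rewrite !ffunE ?ltnSn ?andbT.
    by move: le_v; lia.
  by move=> nH; apply/negP=> /andP[/eqP def_c vb]; rewrite vb in nH; lia.
rewrite /= andbT.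
have -> : (i < n) && upd a (xvar k) v (xvar i) = (i < n) && a (xvar i).
  case: (ltnP i n) => //= lt_i; rewrite ffunE -val_eqE /= xk xvarK; last by lia.
  by rewrite (negPf neq_ik).
case: ifP => le_v; rewrite !ffunE.
  by rewrite ltnS [i <= k]leq_eqVlt (negPf neq_ik) /=; congr (_ && _); lia.
by apply/negP=> /andP[/eqP]; lia.
Qed.

(** Letting [i] range independently of [c] makes one family of cubic size serve all primes
    together. *)
Definition bit_family : {set boolfun N} :=
  [ffun=> false] |: [set bit_at u.1.1 u.1.2 u.2.1 u.2.2 |
    u : ('I_n.+1 * 'I_n.+1) * ('I_n.+1 * bool)].

Lemma bit_familyP k c i b : k <= n -> c <= n -> i <= n ->
  bit_at k c i b \in bit_family.
Proof.
move=> le_k le_c le_i; rewrite inE; apply/orP; right; apply/imsetP.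
exists ((inord k, inord c), (inord i, b)) => //=.
by rewrite !inordK.
Qed.

Lemma card_bit_family : #|bit_family| <= (2 * n.+1 ^ 3).+1.
Proof.
rewrite cardsU1 -[X in _ <= X]add1n; apply: leq_add; first exact: leq_b1.
apply: leq_trans (leq_imset_card _ _) _.
by rewrite !card_prod !card_ord card_bool !expnS expn0; nia.
Qed.

Lemma bcofactor_family F x v :
  F \in bit_family -> top_var F = Some x -> bcofactor F x v \in bit_family.
Proof.
case/setU1P=> [-> /top_var_Some/existsP[a]|]; first by rewrite !ffunE.
case/imsetP=> [[[k c] [i b]] _ /= ->]; move: k c i => [k + ] [c + ] [i +] /=.
rewrite !ltnS => le_k le_c le_i.
have [m] := ubnP (n - k);
  elim: m k le_k c le_c => // m IHm k le_k c le_c lt_m Fx.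
have kx := depends_bit_at (top_var_Some Fx).
have lt_k : k < n by lia.
have xk: xvar k = k :> nat by rewrite xvarK //; lia.
have cofP u : bcofactor (bit_at k c i b) (xvar k) u = [ffun=> false] \/
    exists2 c', c' <= n & bcofactor (bit_at k c i b) (xvar k) u =
      bit_at k.+1 c' i b.
  rewrite bcofactor_bit_at //; case: ifP => _; [right | by left].
  by exists (c - u); first exact: leq_trans (leq_subr _ _) le_c.
(* If [x_k] is inessential, the function equals its own cofactor at [x_k], a member of the family
   with index [k.+1], and the induction continues there. *)
case dk: (depends (bit_at k c i b) (xvar k)).
  have := top_varP (bit_at k c i b); rewrite Fx => -[_ /(_ _ dk) le_xk].
  have -> : x = xvar k by apply: val_inj => /=; lia.
  have [->|[c' le_c' ->]] := cofP v; first exact: setU11.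
  exact: bit_familyP.
have := bcofactor_indep false (negbT dk); have [->|[c' le_c' ->]] := cofP false.
  by move=> defF; rewrite -defF in Fx; have /existsP[a] := top_var_Some Fx;
    rewrite !ffunE.
by move=> defF; rewrite -defF in Fx *; apply: IHm => //; lia.
Qed.

Lemma dsem_hwb a : dsem hwb_prime hwb_sub a (RootG N _) = hwb a.
Proof.
have lt_c : weight 0 a < n.+1 by rewrite ltnS weight_le.
rewrite ffunE /=; apply/existsP/eqP => [[[c b]]|def_z].
  by rewrite /= ffunE /= => /andP[/andP[/eqP-> /eqP->] /eqP].
exists (Ordinal lt_c, (weight 0 a < n) && a (xvar (weight 0 a))).
by rewrite /= ffunE /= !eqxx def_z eqxx.
Qed.

Lemma hwb_prime_disjoint j j' a : hwb_prime j a -> hwb_prime j' a -> j = j'.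
Proof.
case: j j' => [c b] [c' b'];
  rewrite !ffunE /= => /andP[/eqP wc /eqP wb] /andP[/eqP wc' /eqP wb'].
have eq_c : c = c' by apply: val_inj; rewrite /= -wc -wc'.
by rewrite -wb -wb' eq_c.
Qed.

End HiddenWeightedBit.

(** * An OBDD and a small compressed SDD for the function *)

Section HiddenWeightedBitCircuits.
Variable n : nat.
Local Notation N := n.*2.+2.
Implicit Types (a : assignment 'I_N).

Definition xvars (p m : nat) : seq 'I_N := [seq xvar n i | i <- iota p m].

Lemma mem_xvars p m (v : 'I_N) : p <= v < p + m -> v \in xvars p m.
Proof.
by move=> v_pm; apply/mapP; exists (val v);
  rewrite ?mem_iota // /xvar inord_val.
Qed.

Lemma xvars_pairwise p m : p + m <= N ->
  pairwise (fun x y : 'I_N => x < y) (xvars p m).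
Proof.
move=> le_pm; rewrite pairwise_map.
apply/(pairwiseP 0) => i j; rewrite !inE !size_iota => lt_i lt_j lt_ij.
by rewrite /= !nth_iota // !xvarK; lia.
Qed.

Lemma xvars_uniq p m : p + m <= N -> uniq (xvars p m).
Proof.
move=> le_pm; rewrite map_inj_in_uniq ?iota_uniq // => i j.
rewrite !mem_iota => i_pm j_pm /(congr1 (@nat_of_ord _)) eq_ij.
by move: eq_ij; rewrite !xvarK; lia.
Qed.

Lemma rcons_xvars p m : rcons (xvars p m) (xvar n (p + m)) = xvars p m.+1.
Proof. by rewrite /xvars -[m.+1]addn1 iotaD map_cat cats1. Qed.

Lemma depends_hwb x : depends (hwb n) x -> x < n.*2.+1.
Proof.
apply: contraLR => x_ge; apply/dependsPn => a b; rewrite [LHS]ffunE [RHS]ffunE.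
have eq_w : weight 0 (upd a x b) = weight 0 a.
  by apply: eq_weight => v v_n; rewrite ffunE; case: eqP => // eq_v;
    rewrite -eq_v in x_ge; lia.
have le_w := weight_le 0 a.
rewrite /= eq_w ffunE -val_eqE /= zvarK // ifN; last by lia.
case: ltnP => //= lt_w; rewrite ffunE -val_eqE /= xvarK; last by lia.
by rewrite ifN //; lia.
Qed.

(** Its size is irrelevant: it shows that some OBDD computes the function, so that the minimal OBDD
    size exists. *)
Definition hwb_obdd : circuit 'I_N :=
  dcircuit (@hwb_prime n) (@hwb_sub n) (FunG _ (hwb n)).

Lemma hwb_obdd_computes : computes hwb_obdd (hwb n).
Proof. by move=> a; rewrite eval_dcircuit. Qed.

Lemma hwb_obddP : OBDD hwb_obdd.
Proof.
set T := chain (xvars 0 n.*2.+1) (xvar n n.*2.+1).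
exists [set x in leaves T], T; split; last first.
- apply: (@sdd_chain _ _ _ _ _ _ _ (hwb n)) => //.
    by apply: xvars_pairwise; lia.
  by move=> x /depends_hwb lt_x; apply: mem_xvars.
- exact: right_linear_chain.
rewrite /vtree_for eqxx andbT leaves_chain.
rewrite -[X in xvar n X]add0n rcons_xvars xvars_uniq //; lia.
Qed.

Definition hwb_sdd : circuit 'I_N :=
  dcircuit (@hwb_prime n) (@hwb_sub n) (RootG _ _).

Lemma hwb_sdd_computes : computes hwb_sdd (hwb n).
Proof. by move=> a; rewrite eval_dcircuit dsem_hwb. Qed.

Lemma hwb_sub_inj : injective (@hwb_sub n).
Proof.
move=> [c b] [c' b'] [] /(congr1 (@nat_of_ord _)).
rewrite !zvarK -1?ltnS // => /addnI eq_c ->.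
by congr (_, _); apply: val_inj.
Qed.

Lemma hwb_sddP : 0 < n -> SDDc hwb_sdd.
Proof.
move=> n_gt0.
(* On the left the [x] variables, closed by the dummy leaf; on the right [z_0, ..., z_n]. *)
set T := VNode (chain (xvars 0 n) (xvar n n.*2.+1))
               (chain (xvars n n) (xvar n (n + n))).
exists [set x in leaves T], T; split.
  rewrite /vtree_for eqxx andbT /= !leaves_chain rcons_xvars.
  rewrite -cats1 -catA.
  have /perm_uniq-> : perm_eq (xvars 0 n ++ [:: xvar n n.*2.+1] ++ xvars n n.+1)
                              (rcons (xvars 0 n ++ xvars n n.+1) (xvar n
                                n.*2.+1)).
    by rewrite -cats1 -catA perm_cat2l perm_catC.
  have -> : xvars 0 n ++ xvars n n.+1 = xvars 0 n.*2.+1.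
    by rewrite /xvars -map_cat -iotaD addnS addnn.
  rewrite -[X in xvar n X]add0n rcons_xvars xvars_uniq //; lia.
apply: sdd_root => //.
- move=> j j' a; exact: hwb_prime_disjoint.
- move=> a; have := dsem_hwb a;
  have lt_w : weight 0 a < n.+1 by rewrite ltnS weight_le.
  exists (Ordinal lt_w, (weight 0 a < n) && a (xvar n (weight 0 a))).
  by rewrite ffunE /= !eqxx.
(* The events of weight [0] and [n] contain the two constant assignments, and differ since
   [0 < n]. *)
- exists (ord0, false), (ord_max, false); split.
  + apply/existsP; exists (all_false N);
    rewrite ffunE /= !ffunE andbF eqxx andbT.
    by apply/eqP/eqP; rewrite cards_eq0; apply/eqP/setP=> v;
      rewrite !inE ffunE andbF.
  + apply/existsP; exists [ffun=> true]; rewrite ffunE /= ltnn eqxx andbT.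
    rewrite -[X in _ == X]subn0 -(@card_ord_range N 0 n); last by lia.
    by apply/eqP/eq_card=> v; rewrite !inE ffunE andbT.
  + by rewrite xpair_eqE negb_and -val_eqE /= neq_ltn n_gt0.
- exact: hwb_sub_inj.
- by apply: xvars_pairwise; lia.
- by move=> j x /depends_bit_at x_n; apply: mem_xvars.
move=> [c b] /=; rewrite leaves_chain rcons_xvars.
by apply: mem_xvars; rewrite zvarK; have := ltn_ord c; lia.
Qed.

Lemma size_hwb_sdd : size_circuit hwb_sdd <= 3 * N ^ 3.
Proof.
apply: leq_trans (size_dcircuit (S := bit_family n) _ _ _) _.
- by move=> [c b]; apply: bit_familyP => //=; rewrite -ltnS.
- exact: bcofactor_family.
rewrite card_prod card_ord card_bool.
move: #|bit_family n| (card_bit_family n) => m le_m.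
(* With [m = n + 1], the bound is [6 (2 m^3 + 1) + 6 m <= 24 m^3 = 3 N^3]. *)
have -> : N = 2 * n.+1 by lia.
by rewrite expnMn; nia.
Qed.

End HiddenWeightedBitCircuits.

(** * The exponential lower bound for OBDDs *)

Section LowerBound.
Variable w : nat.
Let n := 6 * w.
Let n6 : n = 6 * w := erefl.
Local Notation N := n.*2.+2.

Let X : {set 'I_N} := [set v : 'I_N | v < n].

Lemma cardX : #|X| = n.
Proof.
have -> : X = [set v : 'I_N | 0 <= v < n] by apply/setP=> v; rewrite !inE.
by rewrite card_ord_range; lia.
Qed.

Definition on_set (D : {set 'I_N}) : assignment 'I_N :=
  [ffun v => (v \in D) || (n <= v)].

Lemma hwb_on_set (D : {set 'I_N}) (v : 'I_N) : D \subset X -> v < n ->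
  #|D| = v ->
  hwb n (on_set D) = (v \in D).
Proof.
move=> DX lt_v cardD; rewrite ffunE.
have -> : weight 0 (on_set D) = v.
  rewrite -cardD; apply: eq_card => u; rewrite !inE ffunE /=.
  have := subsetP DX u; rewrite inE.
  by case: (u \in D) => [/(_ isT)->|_] //=; rewrite ltnNge andNb.
rewrite /= lt_v /xvar inord_val !ffunE zvarK; last by lia.
by rewrite leq_addr orbT leqNgt lt_v orbF.
Qed.

(** The start [s] is [w] or [3 * w]. Its bounds let every subset [U] of [W] be completed to [s]
    elements: [#|U| <= w <= s], and the [3 * w] elements of [A :\: W] suffice. *)
Lemma exists_window (A : {set 'I_N}) : A \subset X -> #|A| = 4 * w ->
  exists s (W : {set 'I_N}), [/\ W \subset A, #|W| = w, w <= s <= 3 * w &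
    forall v, v \in W -> s <= v < s + 2 * w].
Proof.
move=> AX cardA; pose H p : {set 'I_N} := [set v : 'I_N | p <= v < p + 2 * w].
have window p : w <= p <= 3 * w -> w <= #|A :&: H p| ->
  exists s (W : {set 'I_N}),
    [/\ W \subset A, #|W| = w, w <= s <= 3 * w &
        forall v, v \in W -> s <= v < s + 2 * w].
  move=> le_p /exists_subset_card[W]; rewrite subsetI => /andP[WA WH] cardW.
  by exists p, W; split=> // v /(subsetP WH); rewrite inE.
have [|lt1] := leqP w #|A :&: H w|; first by apply: window; lia.
have [|lt3] := leqP w #|A :&: H (3 * w)|; first by apply: window; lia.
(* If both windows held fewer than [w] elements of [A], then [A] would have fewer than [4 * w]. *)
have : #|A :&: H w| + #|A :&: H (3 * w)| + #|[set v : 'I_N | 0 <= v < w]|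
   + #|[set v : 'I_N | 5 * w <= v < n]| >= #|A|.
  apply: leq_trans (subset_leq_card _) (leq_trans (leq_card_setU
    (A :&: H w :|: A :&: H (3 * w) :|: [set v : 'I_N | 0 <= v < w])
    [set v : 'I_N | 5 * w <= v < n]) _).
    apply/subsetP=> v vA; have := subsetP AX v vA; rewrite !inE vA /=; lia.
  rewrite leq_add2r; apply: leq_trans (leq_card_setU _ _) _.
  by rewrite leq_add2r leq_card_setU.
by rewrite !card_ord_range; lia.
Qed.

Variable C : circuit 'I_N.
Hypothesis C_obdd : OBDD C.
Hypothesis C_hwb : computes C (hwb n).

Lemma exists_cut :
  exists (A : {set 'I_N}) (s1 s2 : seq 'I_N) (T : vtree 'I_N),
  [/\ A \subset X, #|A| = 4 * w,
      [/\ right_linear T, sdd_at true T (out C) & leaves T = s1 ++ s2],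
      (forall v, v \in s1 -> v \in X -> v \in A) &
      (forall v, v \in s2 -> v \notin A)].
Proof.
have [Y [T [/andP[uniqT _] rlT sddT]]] := C_obdd.
(* [T] may omit variables; appending them guarantees a prefix with exactly [4 * w] of the [x]
   variables. Those of [A] beyond the leaves are then simply never read. *)
pose E := leaves T ++ [seq v <- enum 'I_N | v \notin leaves T].
have uniqE : uniq E.
  rewrite cat_uniq uniqT filter_uniq ?enum_uniq // andbT.
  by apply/hasPn=> v; rewrite mem_filter => /andP[].
have memE v : v \in E by rewrite mem_cat mem_filter mem_enum andbT orbN.
have card_count s : uniq s -> #|[set v in X | v \in s]| = count (mem X) s.
  move=> us; rewrite -size_filter -(card_uniqP (filter_uniq _ us)).
  by apply: eq_card => v; rewrite mem_filter inE.
have [|k def_k] := @exists_take_count _ (mem X) E (4 * w).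
  rewrite -card_count //; have -> : [set v in X | v \in E] = X.
    by apply/setP=> v; rewrite inE memE andbT.
  by rewrite cardX; lia.
exists [set v in X | v \in take k E], (take k (leaves T)),
  (drop k (leaves T)), T.
split.
- by apply/subsetP=> v; rewrite inE => /andP[].
- by rewrite card_count ?take_uniq.
- by rewrite cat_take_drop.
- move=> v v1 vX; rewrite inE vX take_cat.
  by case: ifP => _ //=; rewrite mem_cat (mem_take v1).
move=> v v2; rewrite inE negb_and; apply/orP; right.
have : v \in drop k E.
  rewrite drop_cat; case: ltnP => [_|le_k]; first by rewrite mem_cat v2.
  by rewrite drop_oversize in v2.
have := uniqE; rewrite -{1}(cat_take_drop k E) cat_uniq =>
  /and3P[_ /hasPn nE _].
exact: nE.
Qed.

Lemma hwb_obdd_gates : 2 ^ w <= #|gate C| + 2.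
Proof.
have [A [s1 [s2 [T [AX cardA [rlT sddT defT] s1A s2A]]]]] := exists_cut.
have cardB : #|X :\: A| = 2 * w by rewrite cardsDS // cardA cardX; lia.
have [s [W [WA cardW le_s Ws]]] := exists_window AX cardA.
(* [u.1] completes [U] to weight [s] inside [A], and [u.2] is the sink reached after reading [s1].
   The guard allows a choice for all [U] at once. *)
pose P (U : {set 'I_N}) (u : {set 'I_N} * (gate C + bool)) := U \subset W ->
  [/\ u.1 \subset A :\: W, #|U :|: u.1| = s,
   (forall a : assignment 'I_N, {in s1, a =1 on_set (U :|: u.1)} ->
     eval a (out C) = sink_eval a u.2) &
   (forall a a' : assignment 'I_N, {in s2, a =1 a'} ->
     sink_eval a u.2 = sink_eval a' u.2)].
have [u uP] : exists u, forall U, P U (u U).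
  apply: fin_all_exists => U; have [UW|nUW] := boolP (U \subset W); last first.
    by exists (U, inr true) => UW; rewrite UW in nUW.
  have cardAW : #|A :\: W| = 3 * w by rewrite cardsDS // cardA cardW; lia.
  have leUw := subset_leq_card UW.
  have [|fill fillA card_fill] := @exists_subset_card _ (A :\: W) (s - #|U|).
    by rewrite cardAW; lia.
  have [v v1 v2] := right_linear_prefix (on_set (U :|: fill)) rlT sddT defT.
  exists (fill, v) => _; split=> //=.
  have dis : U :&: fill = set0.
    apply/setP=> x; rewrite in_setI in_set0;
      apply/negP=> /andP[/(subsetP UW) xW].
    by move/(subsetP fillA); rewrite inE xW.
  by rewrite cardsU dis cards0 card_fill; lia.
have key (U U' : {set 'I_N}) : U \subset W -> U' \subset W ->
  (u U).2 = (u U').2 -> U \subset U'.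
  move=> UW U'W eq_u; have [fA cardU u1 u2] := uP U UW.
  have [fA' cardU' u1' _] := uP U' U'W.
  apply/subsetP=> v vU; apply: contraT => vU'.
  have vW := subsetP UW v vU; have vA := subsetP WA v vW.
  have lt_v : v < n by have := subsetP AX v vA; rewrite inE.
  have /andP[le_sv lt_vs] := Ws v vW.
  (* Adding [v - s] ones outside [A] raises the weight from [s] to [v], so that the function reads
     [x_v], which separates [U] from [U']. *)
  have [|D DB cardD] := @exists_subset_card _ (X :\: A) (v - s).
    by rewrite cardB leq_subLR ltnW.
  (* [D] avoids [A], so it is invisible on [s1]; the completed [Z] lies in [A], so it is invisible
     on [s2]. *)
  have hwbE (Z : {set 'I_N}) : Z \subset W ->
    hwb n (on_set ((Z :|: (u Z).1) :|: D)) = (v \in Z) /\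
      {in s1, on_set ((Z :|: (u Z).1) :|: D) =1 on_set (Z :|: (u Z).1)} /\
      {in s2, on_set ((Z :|: (u Z).1) :|: D) =1 on_set D}.
    move=> ZW; have [fAZ cardZ _ _] := uP Z ZW.
    have ZA : Z :|: (u Z).1 \subset A.
      rewrite subUset (subset_trans ZW WA) (subset_trans fAZ) //.
      exact: subsetDl.
    have notD x : x \in A -> x \notin D.
      by move=> xA; apply/negP=> /(subsetP DB); rewrite inE xA.
    have notf : v \notin (u Z).1.
      by apply/negP=> /(subsetP fAZ); rewrite inE vW.
    split; last split.
    - rewrite (@hwb_on_set _ v) //.
      + by rewrite !inE (negPf notf) (negPf (notD v vA)) !orbF.
      + rewrite subUset (subset_trans ZA AX) (subset_trans DB) //;
        exact: subsetDl.
      rewrite cardsU cardZ cardD; have -> : (Z :|: (u Z).1) :&: D = set0.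
        apply/setP=> x; rewrite in_setI in_set0;
          apply/negP=> /andP[/(subsetP ZA) xA].
        by rewrite (negPf (notD x xA)).
      by rewrite cards0 subn0 subnKC.
    - move=> x x1; rewrite !ffunE in_setU; case xD: (x \in D); rewrite ?orbF //.
      have := subsetP DB x xD; rewrite inE => /andP[xA xX].
      by rewrite (s1A x x1 xX) in xA.
    move=> x x2; rewrite !ffunE in_setU.
    by rewrite (negPf (contra (subsetP ZA x) (s2A x x2))).
  have [fU [sU1 sU2]] := hwbE U UW; have [fU' [sU'1 sU'2]] := hwbE U' U'W.
  have eq_f : hwb n (on_set (U :|: (u U).1 :|: D)) =
    hwb n (on_set (U' :|: (u U').1 :|: D)).
    rewrite -!C_hwb (u1 _ sU1) (u1' _ sU'1) -eq_u; apply: u2 => x x2.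
    by rewrite sU2 // sU'2.
  by rewrite fU fU' vU (negPf vU') in eq_f.
have <- : #|powerset W| = 2 ^ w by rewrite card_powerset cardW.
(* The summand 2 counts the constant sinks. *)
have -> : #|gate C| + 2 = #|{: gate C + bool}| by rewrite card_sum card_bool.
rewrite -(@card_in_imset _ _ (fun U => (u U).2) (mem (powerset W))).
  exact: max_card.
move=> U U'; rewrite !inE => UW U'W eq_u; apply/eqP.
by rewrite eqEsubset (key U U') // (key U' U).
Qed.

End LowerBound.

(** * Minimal sizes and the asymptotic bounds *)

Lemma exists_class_size n (L : circuit 'I_n -> Prop) (f : boolfun n) C :
  L C -> computes C f -> exists s, class_size L f s.
Proof.
move=> LC Cf.
pose P s := `[< exists D, [/\ L D, computes D f & size_circuit D = s] >].
have exP : exists s, P s by exists (size_circuit C); apply/asboolP; exists C.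
have [s /asboolP Ps s_min] := ex_minnP exP; exists s; split=> // D LD Df.
by apply: s_min; apply/asboolP; exists D.
Qed.

Variant hwb_family : forall n : nat, boolfun n -> Prop :=
  HwbFamily w : hwb_family (hwb (6 * w)).

Local Open Scope ring_scope.

Theorem theorem4 (R : realType) :
  exists F : forall n : nat, boolfun n -> Prop,
    (forall N : nat, exists (n : nat) (f : boolfun n), (N <= n)%N /\ F n f) /\
    (exists (c : R) (n0 : nat),
       forall (n : nat) (f : boolfun n), F n f -> (n0 <= n)%N ->
       exists s : nat, class_size (@SDDc 'I_n) f s /\ s%:R <= c * n%:R ^+ 3) /\
    (exists (d : R) (n0 : nat), 0 < d /\
       forall (n : nat) (f : boolfun n), F n f -> (n0 <= n)%N ->
       exists s : nat, class_size (@OBDD 'I_n) f s /\ 2 `^ (d * n%:R) <= s%:R).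
Proof.
exists hwb_family; split=> [N|].
  by exists (6 * N)%N.*2.+2, (hwb (6 * N)%N); split; [lia | constructor].
split.
  (* The arity is [12 w + 2], so the threshold 3 excludes [w = 0]. *)
  exists 3, 3 => _ _ [w] n_ge3; have w_gt0 : (0 < 6 * w)%N by lia.
  have [s s_size] := exists_class_size (hwb_sddP w_gt0) (@hwb_sdd_computes _).
  exists s; split=> //; have [_ /(_ _ (hwb_sddP w_gt0))] := s_size.
  move=> /(_ (@hwb_sdd_computes _)) /leq_trans/(_ (size_hwb_sdd _)) le_s.
  by rewrite -natrX -natrM ler_nat.
(* Arity at least 50 means [w >= 4], and then [12 w + 2 <= 28 (w - 2)]. *)
exists 28^-1, 50; split=> [|_ _ [w] n_ge]; first by rewrite invr_gt0.
have [s s_size] := exists_class_size (hwb_obddP (6 * w)%N)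
  (@hwb_obdd_computes _).
exists s; split=> //; have [[C [CO Ch <-]] _] := s_size.
have gates := hwb_obdd_gates CO Ch; have := card_gate_size C => le_gates.
have w_ge4 : (4 <= w)%N by lia.
(* The size is at least [2^w - 3 = 4 * 2^(w-2) - 3], and [3 <= 3 * 2^(w-2)]. *)
have le_pow : (2 ^ (w - 2) <= size_circuit C)%N.
  have : (2 ^ w = 4 * 2 ^ (w - 2))%N.
    by rewrite -[4%N]/(2 ^ 2)%N -expnD subnKC //; lia.
  have := expn_gt0 2 (w - 2); lia.
apply: le_trans (_ : 2 `^ (w - 2)%:R <= _).
  apply: ler_powR; first by rewrite ler1n.
  rewrite mulrC ler_pdivrMr // -natrM ler_nat; lia.
by rewrite powR_mulrn // -natrX ler_nat.
Qed.
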